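(* Assume the following holds: for every $\varepsilon>0$ there is a constant $C_\varepsilon$ such that for every positive integer $n$, every skew corner-free set $S\subseteq[n]^2$ satisfies $|S|\le C_\varepsilon n^{1+\varepsilon}$. Then the family of groups $\mathcal{F}=\{\mathbb{Z}_q^\ell : q \text{ a prime power},\ \ell\ge 1\}$ does not achieve $\omega=2$ via STPP constructions.
   Context: $[n]=\{1,\dots,n\}$. A set $S\subseteq[n]^2$ is skew corner-free if it contains no three points of the form $(x,y),(x,y+\delta),(x+\delta,y')$ with $\delta\neq 0$ (here $y'$ is arbitrary). For a finite group $G$ (written multiplicatively, identity $1$), subsets $S,T,U\subseteq G$ satisfy the triple product property (TPP) if $s s'^{-1} t t'^{-1} u u'^{-1}=1$ with $s,s'\in S$, $t,t'\in T$, $u,u'\in U$ implies $s=s'$, $t=t'$, $u=u'$. Triples $(S_i,T_i,U_i)_{i=1}^k$ of subsets of $G$ satisfy the simultaneous triple product property (STPP) if (1) each $(S_i,T_i,U_i)$ satisfies the TPP, and (2) for all $i,j,l$, whenever $x\in S_iT_i^{-1}$, $y\in T_jU_j^{-1}$, $z\in U_lS_l^{-1}$ satisfy $xyz=1$, then $i=j=l$. A family $\mathcal{F}$ of finite abelian groups achieves $\omega=2$ via STPP constructions if for every $\delta>0$ there exist $G\in\mathcal{F}$ and triples $(S_i,T_i,U_i)_{i=1}^k$ in $G$ satisfying the STPP with $\sum_{i}(|S_i||T_i||U_i|)^{(2+\delta)/3}>|G|$ (i.e. the Cohn–Kleinberg–Szegedy–Umans inequality $\sum_i(|S_i||T_i||U_i|)^{\omega/3}\le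 |G|$ certifies $\omega<2+\delta$). *)

(* Defs.v *)
From mathcomp Require Import all_boot all_order all_fingroup all_algebra.
From mathcomp Require Import reals exp.

Set Implicit Arguments.
Unset Strict Implicit.
Unset Printing Implicit Defensive.

Import Order.TTheory GRing.Theory Num.Theory.
Local Open Scope ring_scope.

(* 'I_n stands for [n] = {1, ..., n}: a skew corner only involves differences
   of coordinates. The shift d is an integer, of either sign. *)
Definition skew_corner_free (n : nat) (S : {set 'I_n * 'I_n}) : Prop :=
  forall (x y y1 x2 y2 : 'I_n) (d : int),
    d != 0 -> y1%:Z = y%:Z + d -> x2%:Z = x%:Z + d ->
    ~ [/\ (x, y) \in S, (x, y1) \in S & (x2, y2) \in S].

Definition skew_corner_free_bound (R : realType) : Prop :=
  forall e : R, 0 < e ->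
    exists C : R, forall n : nat, (0 < n)%N ->
      forall S : {set 'I_n * 'I_n}, skew_corner_free S ->
        #|S|%:R <= C * n%:R `^ (1 + e).

Definition TPP (gT : finGroupType) (S T U : {set gT}) : Prop :=
  forall s s' t t' u u' : gT,
    s \in S -> s' \in S -> t \in T -> t' \in T -> u \in U -> u' \in U ->
    (s * s'^-1 * t * t'^-1 * u * u'^-1 = 1)%g ->
    [/\ s = s', t = t' & u = u'].

(* Products and inverses of subsets are the pointwise ones. *)
Definition STPP (gT : finGroupType) (k : nat) (S T U : 'I_k -> {set gT}) :
    Prop :=
  (forall i : 'I_k, TPP (S i) (T i) (U i)) /\
  (forall (i j l : 'I_k) (x y z : gT),
     (x \in S i * (T i)^-1)%g -> (y \in T j * (U j)^-1)%g ->
     (z \in U l * (S l)^-1)%g ->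
     (x * y * z = 1)%g -> i = j /\ j = l).

Definition achieves_omega2_STPP (R : realType) (F : finGroupType -> Prop) :
    Prop :=
  forall d : R, 0 < d ->
    exists (gT : finGroupType) (k : nat) (S T U : 'I_k -> {set gT}),
      [/\ F gT, STPP S T U &
          #|gT|%:R <
            \sum_(i < k) (#|S i| * #|T i| * #|U i|)%:R `^ ((2 + d) / 3)].

Definition prime_power (q : nat) : Prop :=
  exists p m : nat, [/\ prime p, (0 < m)%N & q = (p ^ m)%N].

(* The group law of the finGroupType 'rV['Z_q]_l is vector addition; a prime
   power is at least 2, so 'Z_q really is the ring of integers mod q. *)
Definition prime_power_homocyclic (gT : finGroupType) : Prop :=
  exists q l : nat,
    [/\ prime_power q, (0 < l)%N & gT = ('rV['Z_q]_l : finGroupType)].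

(* Main.v *)
Require Import Defs.
From mathcomp Require Import all_boot all_order all_fingroup all_algebra.
From mathcomp Require Import reals exp.
From mathcomp Require Import zify ring lra.

(* Let v_i = |S_i||T_i||U_i| for an STPP family in G = Z_q^l, q a prime power.

   The points (s - t, t - u), with (s, t, u) in some S_i x T_i x U_i, form a
   skew corner-free subset of G^2. Writing elements of G in base 2q, so that
   sums of two digits produce no carry, embeds it and all its powers into grids
   [n]^2 as skew corner-free sets, whence sum v_i <= (2q)^l.

   On the other hand, by the slice-rank method (the indicator of 0 in Z_q is a
   binomial coefficient modulo p), a tricolored sum-free set in Z_q^l has at most
   3 (gam q)^l elements, where gam < 1 does not depend on q. Strassen's degeneration
   of matrix multiplication to a diagonal, made effective by fixing the weights
   in a high power, turns an STPP family with |S_i| = |T_i| = |U_i| into such a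
   set; symmetrizing the blocks of one type in a high power of the family gives
   sum v_i^(2/3) <= (gam q)^l in general.

   Interpolating between the two bounds, sum v_i^(11/16) <= q^l because
   gam^(15/16) 2^(1/16) <= 1; this excludes the exponent delta = 1/16. *)

Set Implicit Arguments.
Unset Strict Implicit.
Unset Printing Implicit Defensive.

Import Order.TTheory GRing.Theory Num.Theory.
Local Open Scope ring_scope.

(** * Tricolored sum-free sets *)

Lemma coef_X1n (F : comNzRingType) (n i : nat) :
  (('X + 1) ^+ n : {poly F})`_i = ('C(n, i))%:R.
Proof.
rewrite addrC exprDn coef_sum.
case: (ltnP n i) => [lt|le].
  rewrite bin_small // big1 // => j _.
  rewrite expr1n mul1r coefMn coefXn.
  by rewrite gtn_eqF ?mul0rn // (leq_trans (ltn_ord j)).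
have lt : (i < n.+1)%N by [].
rewrite (bigD1 (Ordinal lt)) //= expr1n mul1r coefMn coefXn eqxx.
rewrite big1 ?addr0 // => j jne; rewrite expr1n mul1r coefMn coefXn.
rewrite (_ : (i == j :> nat) = false) ?mul0rn //.
by apply: contraNF jne => /eqP e; apply/eqP/val_inj.
Qed.

(** With q = p^m, the binomial is the coefficient of X^(q-1) in (X+1)^(n+q-1). Modulo p, (X+1)^q =
    X^q + 1, and multiplying by powers of X^q + 1 leaves coefficients below degree q unchanged. What
    remains is (X+1)^r, with r the residue of n+q-1 modulo q, and r = q-1 exactly when q divides
    n. *)
Lemma bin_pchar_dvd (p m n : nat) : prime p ->
  ('C(n + (p ^ m).-1, (p ^ m).-1))%:R = (p ^ m %| n)%N%:R :> 'F_p.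
Proof.
move=> pp; set q := (p ^ m)%N.
have q0 : (0 < q)%N by rewrite expn_gt0 prime_gt0.
have chF : p \in [pchar {poly 'F_p}] by rewrite pchar_poly pchar_Fp.
have qn : [pchar {poly 'F_p}].-nat q by rewrite pnatX pnatE // chF.
have frob s r : (('X + 1) ^+ (s * q + r) : {poly 'F_p}) = ('X^q + 1) ^+ s * ('X + 1) ^+ r.
  by rewrite exprD mulnC exprM (exprDn_pchar _ _ qn) expr1n.
have low s (P : {poly 'F_p}) : ((('X^q + 1) ^+ s * P)`_q.-1) = P`_q.-1.
  elim: s => [|s IH]; first by rewrite expr0 mul1r.
  rewrite exprS -mulrA mulrDl mul1r coefD IH coefXnM.
  by rewrite prednK // leqnn add0r.
have -> : ('C(n + q.-1, q.-1))%:R = (('X + 1) ^+ (n + q.-1) : {poly 'F_p})`_q.-1.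
  by rewrite coef_X1n.
rewrite {1}(divn_eq n q) /dvdn; case: (n %% q)%N (ltn_pmod n q0) => [|r] rq.
  by rewrite addn0 frob low coef_X1n binn.
have -> : (n %/ q * q + r.+1 + q.-1 = (n %/ q).+1 * q + r)%N by lia.
by rewrite frob low coef_X1n bin_small //; lia.
Qed.

(** Coefficients of the expansion [bin_trinom], which iterates the Vandermonde identity. Their
    vanishing for a + b + c > Q is the degree bound behind the slice-rank argument. *)
Definition trinom_coef (Q a b c : nat) : nat :=
  if (a + b + c <= Q)%N then 'C(Q, Q - (a + b + c)) else 0.

(** The range of j depends on Q rather than i, so that iteration gives a sum over a fixed box. *)
Lemma Vandermonde_ext (k l i Q : nat) : (i <= Q)%N ->
  'C(k + l, i) =
  (\sum_(j < Q.+1) 'C(k, j) * (if j <= i then 'C(l, i - j) else 0))%N.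
Proof.
move=> iQ; rewrite -binomial.Vandermonde.
rewrite (big_ord_widen Q.+1 (fun j => 'C(k, j) * 'C(l, i - j))%N) //.
rewrite big_mkcond; apply: eq_bigr => j _.
by rewrite ltnS; case: ifP => // _; rewrite muln0.
Qed.

Lemma bin_trinom (Q x y z : nat) :
  'C(x + y + z + Q, Q) =
  (\sum_(t : 'I_Q.+1 * 'I_Q.+1 * 'I_Q.+1)
     trinom_coef Q t.1.1 t.1.2 t.2 * ('C(x, t.1.1) * 'C(y, t.1.2) * 'C(z, t.2)))%N.
Proof.
rewrite -!addnA (Vandermonde_ext _ _ (leqnn Q)).
rewrite (eq_bigr (fun a : 'I_Q.+1 => \sum_(b < Q.+1) \sum_(c < Q.+1)
   trinom_coef Q a b c * ('C(x, a) * 'C(y, b) * 'C(z, c)))%N); last first.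
  move=> a _; have aQ : (a <= Q)%N by rewrite -ltnS.
  rewrite aQ (Vandermonde_ext _ _ (leq_subr a Q)) big_distrr /=.
  apply: eq_bigr => b _; case: ifP => ab; last first.
    rewrite !muln0 big1 // => c _; rewrite /trinom_coef ifF ?mul0n //; lia.
  rewrite (@Vandermonde_ext z Q _ Q) ?(leq_trans (leq_subr _ _)) ?leq_subr //.
  rewrite !big_distrr /=; apply: eq_bigr => c _.
  rewrite /trinom_coef; case: ifP => abc.
    rewrite ifT; last by lia.
    by rewrite (_ : (Q - a - b - c = Q - (a + b + c))%N); [lia|lia].
  by rewrite ifF ?muln0 ?mul0n //; lia.
rewrite pair_big pair_big /=; apply: eq_bigr => -[[a b] c] _ //.
Qed.

(* Choosing [h] with value 1 at the pivots of a basis of the left kernel. *)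
Lemma kernel_full_support (F : fieldType) (M m : nat) (C : 'M[F]_(M, m)) :
  exists d (f : 'I_d -> 'I_M) (h : 'I_M -> F),
    [/\ (M <= d + m)%N, injective f, forall l, \sum_k h k * C k l = 0
      & forall l, h (f l) = 1].
Proof.
pose K := row_base (kermx C).
have Kf : row_full K^T by rewrite /row_full mxrank_tr; apply: row_base_free.
pose A := rowsub (fullrankfun Kf) K^T.
have Au : A \in unitmx by exact: fullrowsub_unit.
pose w : 'cV[F]_(\rank (kermx C)) := invmx A *m const_mx 1.
exists (\rank (kermx C)), (fullrankfun Kf), (fun k => (K^T *m w) k 0).
split.
- by rewrite mxrank_ker; have := rank_leq_col C; lia.
- exact: fullrankfun_inj.
- move=> l.
  have KC : K *m C = 0.
    by apply/sub_kermxP; rewrite /K eq_row_base.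
  have : ((K^T *m w)^T *m C) 0 l = 0.
    by rewrite trmx_mul trmxK -mulmxA KC mulmx0 mxE.
  rewrite mxE => e; rewrite -[RHS]e; apply: eq_bigr => k _.
  by rewrite [in RHS]mxE.
- move=> l; have : (A *m w) l 0 = 1 by rewrite /w mulKVmx // mxE.
  by move=> <-; rewrite !mxE; apply: eq_bigr => k _; rewrite !mxE.
Qed.

Definition low_exponents (X : finType) (Q : nat) : {set {ffun X -> 'I_Q.+1}} :=
  [set g : {ffun X -> 'I_Q.+1} | (3 * \sum_x (g x : nat) <= Q * #|X|)%N].

(** * The slice-rank argument *)

Section SliceRank.
Variables (p m : nat) (X : finType) (M : nat) (a b c : 'I_M -> X -> nat).
Hypothesis pp : prime p.
Hypothesis tricolored : forall i j k : 'I_M,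
  (forall x, p ^ m %| a i x + b j x + c k x)%N <-> i = j /\ j = k.

Let Q := (p ^ m).-1.
Let mon (v : 'I_M -> X -> nat) (g : {ffun X -> 'I_Q.+1}) (i : 'I_M) : 'F_p :=
  (\prod_x 'C(v i x, g x))%N%:R.
Let E := {ffun X -> 'I_Q.+1 * 'I_Q.+1 * 'I_Q.+1}.
Let pA (f : E) := [ffun x => (f x).1.1].
Let pB (f : E) := [ffun x => (f x).1.2].
Let pC (f : E) := [ffun x => (f x).2].
Let kappa (f : E) : 'F_p :=
  (\prod_x trinom_coef Q (f x).1.1 (f x).1.2 (f x).2)%N%:R.
Let Low := low_exponents X Q.

(** The diagonal tensor is a product over the coordinates x of divisibility indicators, each a
    binomial coefficient modulo p; expanding all of them gives a combination of products of three
    monomials. *)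
Let tensor_expand i j k :
  \sum_(f : E) kappa f * (mon a (pA f) i * mon b (pB f) j * mon c (pC f) k)
  = ((i == j) && (j == k))%:R.
Proof.
have -> : ((i == j) && (j == k))%:R =
    (\prod_x 'C(a i x + b j x + c k x + Q, Q))%N%:R :> 'F_p.
  rewrite natr_prod (eq_bigr (fun x => (p ^ m %| a i x + b j x + c k x)%N%:R));
    last by move=> x _; rewrite bin_pchar_dvd.
  have -> : ((i == j) && (j == k)) = [forall x, p ^ m %| a i x + b j x + c k x]%N.
    apply/andP/forallP => [[/eqP ij /eqP jk]|H].
      by apply/tricolored.
    by case/tricolored: H => -> ->.
  case: forallP => [H|/forallP]; first by rewrite big1 // => x _; rewrite H.
  rewrite negb_forall => /existsP[x /negbTE nx].
  by rewrite (bigD1 x) //= nx mul0r.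
rewrite (eq_bigr _ (fun x _ => bin_trinom Q (a i x) (b j x) (c k x))).
rewrite bigA_distr_bigA natr_sum; apply: eq_bigr => f _.
rewrite big_split /= !big_split /= !natrM /kappa /mon.
by congr (_ * (_ * _ * _)); congr (_%:R); apply: eq_bigr => x _; rewrite ffunE.
Qed.

(** If [kappa f] is nonzero, the three degrees add up to at most Q |X|, so one of them is at most a
    third of this. *)
Let one_low f : kappa f != 0 -> [|| pA f \in Low, pB f \in Low | pC f \in Low].
Proof.
move=> kf.
have le x : ((f x).1.1 + (f x).1.2 + (f x).2 <= Q)%N.
  apply: contraNT kf => nle; apply/eqP.
  by rewrite /kappa (bigD1 x) //= /trinom_coef (negbTE nle) mul0n.
have : (\sum_x ((f x).1.1 + (f x).1.2 + (f x).2) <= Q * #|X|)%N.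
  by rewrite mulnC -sum_nat_const leq_sum.
rewrite !big_split /= !inE.
have -> : (\sum_x pA f x = \sum_x (f x).1.1)%N.
  by apply: eq_bigr => x _; rewrite ffunE.
have -> : (\sum_x pB f x = \sum_x (f x).1.2)%N.
  by apply: eq_bigr => x _; rewrite ffunE.
have -> : (\sum_x pC f x = \sum_x (f x).2)%N.
  by apply: eq_bigr => x _; rewrite ffunE.
set u := (\sum_x _)%N; set v := (\sum_x _)%N; set w := (\sum_x _)%N.
move=> H; apply: contraT; rewrite !negb_or -!ltnNge; move: H; move: u v w (_ * _)%N => u v w n H /and3P[]; lia.
Qed.

(** Contract the third index with a function h that kills every low monomial in c and equals 1 on at
    least M - |Low| points. On these points the diagonal tensor becomes an identity matrix, while
    each surviving term has a low monomial in a or b, so the rank is at most 2 |Low|. *)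
Lemma tricolored_leq_low : (M <= 3 * #|Low|)%N.
Proof.
pose e (l : 'I_#|Low|) := enum_val l.
have [d [f [h [Md finj hC hf]]]] :=
  kernel_full_support (\matrix_(k < M, l < #|Low|) mon c (e l) k).
suff dle : (d <= #|Low| + #|Low|)%N by lia.
have hlow g : g \in Low -> \sum_k h k * mon c g k = 0.
  move=> gL; rewrite -[RHS](hC (enum_rank_in gL g)).
  by apply: eq_bigr => k _; rewrite mxE /e enum_rankK_in.
pose H g := \sum_k h k * mon c g k.
pose A1 := \matrix_(i < d, l < #|Low|) mon a (e l) (f i).
pose B1 := \matrix_(l < #|Low|, j < d)
  \sum_(t : E | pA t == e l) kappa t * mon b (pB t) (f j) * H (pC t).
pose A2 := \matrix_(i < d, l < #|Low|)
  \sum_(t : E | (pA t \notin Low) && (pB t == e l)) kappa t * mon a (pA t) (f i) * H (pC t).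
pose B2 := \matrix_(l < #|Low|, j < d) mon b (e l) (f j).
(* The first product collects the terms with a low monomial in a, the second those where only the
   monomial in b is known to be low. *)
have id : 1%:M = A1 *m B1 + A2 *m B2.
  apply/matrixP => i j; rewrite !mxE.
  transitivity (\sum_(t : E) kappa t * (mon a (pA t) (f i) * mon b (pB t) (f j)) * H (pC t)).
    transitivity (\sum_k h k * ((f i == f j) && (f j == k))%:R).
      rewrite (bigD1 (f j)) //= eqxx andbT hf mul1r big1 ?addr0.
        by rewrite (inj_eq finj).
      by move=> k kj; rewrite [f j == k]eq_sym (negbTE kj) andbF mulr0.
    under eq_bigr => k _ do rewrite -tensor_expand mulr_sumr.
    rewrite exchange_big /=; apply: eq_bigr => t _; rewrite /H mulr_sumr.
    by apply: eq_bigr => k _; ring.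
  rewrite (bigID (fun t => pA t \in Low)) /=; congr (_ + _).
    rewrite (partition_big pA (mem Low)) //= (big_enum_val) /=.
    apply: eq_bigr => l _; rewrite !mxE mulr_sumr.
    apply: eq_big => [t|t]; last first.
      by move=> /andP[_ /eqP ->]; rewrite /e; ring.
    by rewrite /e; case: eqP => [->|]; rewrite ?andbF // enum_valP.
  rewrite (bigID (fun t => pB t \in Low)) /= [X in _ + X]big1 ?addr0; last first.
    move=> t /andP[nA nB]; have [->|k0] := eqVneq (kappa t) 0; first by rewrite !mul0r.
    by have := one_low k0; rewrite (negbTE nA) (negbTE nB) /= => /hlow; rewrite /H => ->; rewrite mulr0.
  rewrite (partition_big pB (mem Low)) //=; last by move=> t /andP[].
  rewrite big_enum_val /=.
  apply: eq_bigr => l _; rewrite !mxE mulr_suml.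
  apply: eq_big => [t|t]; last first.
    by move=> /andP[_ /eqP ->]; rewrite /e; ring.
  rewrite /e; case: eqP => [->|]; rewrite ?andbF // enum_valP ?andbT //.
have := mxrank_add (A1 *m B1) (A2 *m B2).
rewrite -id mxrank1 => /leq_trans; apply.
apply: leq_add; apply: leq_trans (mxrankM_maxl _ _) (rank_leq_col _).
Qed.

End SliceRank.

(* The saving of the slice-rank bound in Z_q^l, uniform in q. *)
Definition gam (R : realType) : R := 3 / 4 * 2 `^ 3^-1.

(** * Growth estimates and the count of low exponents *)

Section Growth.
Variable R : realType.

Lemma powR_rootK (x : R) (n : nat) : (0 < n)%N -> 0 <= x -> (x `^ n%:R^-1) ^+ n = x.
Proof.
move=> n0 x0; rewrite -powR_mulrn ?powR_ge0 // -powRrM mulVf ?powRr1 //.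
by rewrite pnatr_eq0 -lt0n.
Qed.

Lemma gam_gt0 : 0 < gam R.
Proof. by rewrite /gam mulr_gt0 ?powR_gt0 //; lra. Qed.

Lemma gam_exp3 : gam R ^+ 3 = 27 / 32.
Proof. by rewrite /gam exprMn powR_rootK //; field. Qed.

Lemma bernoulli (h : R) n : -1 <= h -> 1 + n%:R * h <= (1 + h) ^+ n.
Proof.
move=> h1; elim: n => [|n IH]; first by rewrite mul0r addr0 expr0.
rewrite exprS; apply: le_trans (ler_wpM2l _ IH); last by lra.
rewrite -natr1 -subr_ge0.
rewrite (_ : _ - _ = n%:R * h ^+ 2); last by ring.
by rewrite mulr_ge0 ?sqr_ge0.
Qed.

(** Otherwise (x/y)^r would grow exponentially. This discards the polynomial losses of every passage
    to high powers below. *)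
Lemma le_of_poly_growth (x y C : R) (k : nat) : 0 <= x -> 0 <= y ->
  (forall r, x ^+ r <= C * r.+1%:R ^+ k * y ^+ r) -> x <= y.
Proof.
move=> x0 y0 H; rewrite leNgt; apply/negP => yx.
have [y00|yn0] := eqVneq y 0.
  by have := H 1%N; rewrite y00 !expr1 mulr0; rewrite y00 in yx; lra.
have yp : 0 < y by rewrite lt_def yn0.
(* The cap at 1 gives (n+1) h <= 1 + n h, the form in which Bernoulli is applied. *)
pose h := Num.min (x / y - 1) 1.
have hp : 0 < h by rewrite /h lt_min ltr01 andbT subr_gt0 ltr_pdivlMr // mul1r.
have h1 : h <= 1 by rewrite /h ge_min lexx orbT.
have hz : 1 + h <= x / y.
  have : h <= x / y - 1 by rewrite /h ge_min lexx.
  lra.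
have C0 : 0 <= C by have := H 0%N; rewrite !expr0 expr1n; lra.
(* Take r = n (k+1): the left side grows at least like (n+1)^(k+1), one degree more than the
   right. *)
have key n : n.+1%:R * h ^+ k.+1 <= C * k.+1%:R ^+ k.
  have n0 : 0 < n.+1%:R :> R by [].
  have L1 : (n.+1%:R * h) ^+ k.+1 <= (x / y) ^+ (n * k.+1).
    rewrite exprM; apply: lerXn2r; rewrite ?nnegrE.
    - by rewrite mulr_ge0 // ltW.
    - by rewrite exprn_ge0 // divr_ge0.
    apply: (@le_trans _ _ ((1 + h) ^+ n)); last first.
      by apply: lerXn2r hz; rewrite ?nnegrE ?divr_ge0 //; lra.
    apply: le_trans (bernoulli n _); last by lra.
    by rewrite -natr1 mulrDl mul1r addrC lerD2r.
  have L2 : (x / y) ^+ (n * k.+1) <= C * (n * k.+1).+1%:R ^+ k.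
    by rewrite expr_div_n ler_pdivrMr ?exprn_gt0.
  have L3 : C * (n * k.+1).+1%:R ^+ k <= C * (n.+1%:R * k.+1%:R) ^+ k.
    rewrite ler_wpM2l // lerXn2r ?nnegrE ?mulr_ge0 //.
    by rewrite -natrM ler_nat mulSn addSn ltnS leq_addl.
  have := le_trans L1 (le_trans L2 L3).
  rewrite !exprMn [n.+1%:R ^+ k.+1]exprS mulrA (mulrC _ (h ^+ _)) !mulrA.
  rewrite -[X in _ <= X]mulrA (mulrC (n.+1%:R ^+ k)) [X in _ <= X]mulrA.
  by rewrite ler_pM2r ?exprn_gt0 // mulrC.
have hk : 0 < h ^+ k.+1 by rewrite exprn_gt0.
pose B := C * k.+1%:R ^+ k / h ^+ k.+1.
have := key (Num.bound B); rewrite -ler_pdivlMr // -/B.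
have : B < (Num.bound B)%:R.
  by apply: le_lt_trans (ler_norm _) _; have := archi_boundP (normr_ge0 B); rewrite /Num.bound normr_id.
rewrite -natr1; lra.
Qed.

(** A Chernoff bound: give an exponent the weight t^degree, where t^Q = 1/2. Low exponents weigh at
    least 2^(-|X|/3), and all exponents together at most (3/4 (Q+1))^|X|. *)
Lemma card_low_exponents (X : finType) (Q : nat) : (0 < Q)%N ->
  #|low_exponents X Q|%:R <= (gam R * Q.+1%:R) ^+ #|X|.
Proof.
move=> Q0.
pose c2 : R := 2 `^ 3^-1; have c20 : 0 < c2 by rewrite powR_gt0.
have c23 : c2 ^+ 3 = 2 by rewrite powR_rootK.
pose s := (c2^-1) `^ (Q%:R^-1).
have s0 : 0 < s by apply: powR_gt0; rewrite invr_gt0.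
have sQ : s ^+ Q = c2^-1 by rewrite powR_rootK // invr_ge0 ltW.
have s1 : s <= 1.
  rewrite -(expr_le1 Q0 (ltW s0)) sQ invf_le1 // leNgt; apply/negP => lt.
  have := exprn_ile1 3 (ltW c20) (ltW lt).
  by rewrite c23; lra.
pose t := s ^+ 3.
have t0 : 0 < t by rewrite exprn_gt0.
have t1 : t <= 1 by rewrite exprn_ile1 // ltW.
have tQ : t ^+ Q = 1 / 2 by rewrite /t exprAC sQ exprVn c23; lra.
(* Pair a with Q - a: two numbers in [0,1] with product 1/2 have sum at most 3/2. *)
have avg : \sum_(a < Q.+1) t ^+ a <= 3 / 4 * Q.+1%:R.
  have e : \sum_(a < Q.+1) t ^+ a = \sum_(a < Q.+1) t ^+ (Q - a).
    by rewrite (reindex_inj rev_ord_inj); apply: eq_bigr.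
  have : \sum_(a < Q.+1) (t ^+ a + t ^+ (Q - a)) <= \sum_(a < Q.+1) (3 / 2 : R).
    apply: ler_sum => a _.
    have aQ : (a <= Q)%N by rewrite -ltnS.
    have := mulr_ge0 (_ : 0 <= 1 - t ^+ a) (_ : 0 <= 1 - t ^+ (Q - a)).
    have ta : t ^+ a * t ^+ (Q - a) = 1 / 2 by rewrite -exprD subnKC.
    have l1 : t ^+ a <= 1 by rewrite exprn_ile1 // ltW.
    have l2 : t ^+ (Q - a) <= 1 by rewrite exprn_ile1 // ltW.
    by move=> /(_ ltac:(lra) ltac:(lra)); nra.
  rewrite big_split /= -e sumr_const card_ord -mulr_natr; lra.
have low g : g \in low_exponents X Q -> (c2^-1) ^+ #|X| <= \prod_x t ^+ (g x : nat).
  rewrite inE => lg; rewrite prodrXr -sQ -!exprM.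
  by rewrite ler_wiXn2l // ltW.
have tot : \sum_(g : {ffun X -> 'I_Q.+1}) \prod_x t ^+ (g x : nat) <= (3 / 4 * Q.+1%:R) ^+ #|X|.
  rewrite -(bigA_distr_bigA (fun (x : X) (a : 'I_Q.+1) => t ^+ a)) /= prodr_const.
  by rewrite lerXn2r ?nnegrE ?sumr_ge0 // => [a _|]; rewrite ?exprn_ge0 ?ltW // mulr_gt0 //; lra.
have : #|low_exponents X Q|%:R * (c2^-1) ^+ #|X| <= (3 / 4 * Q.+1%:R) ^+ #|X|.
  apply: le_trans tot; rewrite (bigID (mem (low_exponents X Q))) /=.
  apply: ler_wpDr; first by rewrite sumr_ge0 // => g _; rewrite prodr_ge0 // => x _; rewrite exprn_ge0 ?ltW.
  by rewrite mulr_natl -sumr_const ler_sum.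
rewrite exprVn ler_pdivrMr ?exprn_gt0 // -exprMn => /le_trans; apply.
by rewrite /gam (mulrAC _ c2).
Qed.
End Growth.

Lemma tricolored_card (R : realType) (p m : nat) (X W : finType) (a b c : W -> X -> nat) :
  prime p -> (0 < m)%N ->
  (forall i j k, (forall x, p ^ m %| a i x + b j x + c k x)%N <-> i = j /\ j = k) ->
  #|W|%:R <= 3 * (gam R * (p ^ m)%:R) ^+ #|X|.
Proof.
move=> pp m0 H.
have q1 : (1 < p ^ m)%N by rewrite -(expn0 p) ltn_exp2l ?prime_gt1.
have := @tricolored_leq_low p m X #|W| (a \o enum_val) (b \o enum_val) (c \o enum_val) pp.
move=> /(_ _)/wrap[|le].
  move=> i j k; rewrite /= H; split=> [[/enum_val_inj -> /enum_val_inj ->]|[-> ->]] //.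
apply: le_trans (_ : (3 * #|low_exponents X (p ^ m).-1|)%:R <= _).
  by rewrite ler_nat.
rewrite natrM ler_pM2l // (le_trans (card_low_exponents _ _ _)) //.
  by lia.
by rewrite prednK // ltnW.
Qed.

(** * Sum-free sets up to degeneration *)

Section Weighted.
Variables (R : realType) (p m : nat) (X W : finType) (a b c : W -> X -> nat).
Variables (wa wb wc : W -> int).
Hypotheses (pp : prime p) (m0 : (0 < m)%N).
Hypothesis weight_ge0 : forall i j k, (forall x, p ^ m %| a i x + b j x + c k x)%N ->
  0 <= wa i + wb j + wc k /\ (wa i + wb j + wc k = 0 -> i = j /\ j = k).
Hypothesis diag : forall i, (forall x, p ^ m %| a i x + b i x + c i x)%N.
Hypothesis diag_weight : forall i, wa i + wb i + wc i = 0.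

(* In a high power, the elements whose total weights take the most popular
   value form a tricolored sum-free set, and there are only polynomially many
   values. *)
Lemma weighted_tricolored_card : #|W|%:R <= (gam R * (p ^ m)%:R) ^+ #|X|.
Proof.
pose K := (\sum_i (`|wa i| + `|wb i|))%N.
have Ka i : (`|wa i| <= K)%N by rewrite /K (bigD1 i) //=; lia.
have Kb i : (`|wb i| <= K)%N by rewrite /K (bigD1 i) //=; lia.
have P0 : 0 <= gam R * (p ^ m)%:R by rewrite mulr_ge0 // ltW // gam_gt0.
(* The two totals lie in [-rK, rK], giving (2rK+1)^2 classes, at most ((2K+1)(r+1))^2; the 3 is the
   slice-rank constant. *)
apply: (@le_of_poly_growth _ _ _ (3 * (2 * K + 1)%:R ^+ 2) 2) => // [|r].
  by rewrite exprn_ge0.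
pose tot (w : W -> int) (f : {ffun 'I_r -> W}) : int := \sum_e w (f e).
have totK w f : (forall i, `|w i| <= K)%N -> (`|tot w f| <= r * K)%N.
  move=> wK; rewrite -lez_nat abszE (le_trans (ler_norm_sum _ _ _)) //.
  rewrite (le_trans (_ : _ <= \sum_(e < r) K%:Z)) //.
    by apply: ler_sum => e _; rewrite -abszE lez_nat.
  by rewrite sumr_const card_ord -mulr_natr natz -PoszM lez_nat mulnC.
pose N := (2 * (r * K))%N.
pose cls f : 'I_N.+1 * 'I_N.+1 :=
  (inord (absz (tot wa f + (r * K)%:Z)), inord (absz (tot wb f + (r * K)%:Z))).
have clsE f g : cls f = cls g -> tot wa f = tot wa g /\ tot wb f = tot wb g.
  case=> /(congr1 val) /= + /(congr1 val) /=.
  have := totK _ f Ka; have := totK _ g Ka; have := totK _ f Kb; have := totK _ g Kb.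
  by move=> k1 k2 k3 k4; rewrite !inordK /N; lia.
have bound z : #|[set f | cls f == z]|%:R <= 3 * (gam R * (p ^ m)%:R) ^+ (#|X| * r) :> R.
  pose V := {f | f \in [set f | cls f == z]}.
  pose lift (u : W -> X -> nat) (f : V) (ex : 'I_r * X) := u (val f ex.1) ex.2.
  have -> : (#|X| * r = #|{: 'I_r * X}|)%N by rewrite card_prod card_ord mulnC.
  rewrite -(card_sig (mem [set f | cls f == z])).
  apply: (@tricolored_card _ p m _ V (lift a) (lift b) (lift c)) => //.
  move=> f g h; split; last by move=> [<- <-] [e x]; apply: diag.
  move=> H; have He e x : (p ^ m %| a (val f e) x + b (val g e) x + c (val h e) x)%N.
    exact: (H (e, x)).
  have tz (f' : V) : cls (val f') = z by have := valP f'; rewrite inE => /eqP.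
  have [fg fgb] := clsE _ _ (etrans (tz f) (esym (tz g))).
  have [gh ghb] := clsE _ _ (etrans (tz g) (esym (tz h))).
  (* Within a class, f and g can be replaced by h in the totals, which then cancel by [diag_weight].
     Since every summand is nonnegative, each one vanishes. *)
  have S0 : \sum_e (wa (val f e) + wb (val g e) + wc (val h e)) = 0.
    transitivity (\sum_e (wa (val h e) + wb (val h e) + wc (val h e))).
      by rewrite !big_split /=; move: fg gh ghb; rewrite /tot => -> -> ->.
    by apply: big1 => e _; apply: diag_weight.
  have Z e : wa (val f e) + wb (val g e) + wc (val h e) = 0.
    by apply: (psumr_eq0P _ S0) => // e' _; case: (weight_ge0 (He e')).
  by split; apply/val_inj/ffunP => e; case: (weight_ge0 (He e)) => _ /(_ (Z e))[].
have -> : #|W|%:R ^+ r = #|{ffun 'I_r -> W}|%:R :> R by rewrite card_ffun card_ord natrX.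
rewrite -[X in X%:R]sum1_card (partition_big cls xpredT) //= natr_sum.
rewrite (le_trans (_ : _ <= \sum_(z : 'I_N.+1 * 'I_N.+1) 3 * (gam R * (p ^ m)%:R) ^+ (#|X| * r))) //.
  apply: ler_sum => z _; rewrite sum1_card; apply: le_trans (bound z).
  by rewrite ler_nat; apply/eq_leq/eq_card => f; rewrite !inE.
rewrite sumr_const -[X in X <= _]mulr_natr card_prod card_ord exprM.
rewrite -[X in X <= _]mulrA [X in _ * X]mulrC mulrA.
rewrite ler_wpM2r ?exprn_ge0 // -mulrA ler_pM2l // natrM -expr2 -exprMn.
by apply: lerXn2r; rewrite ?nnegrE ?mulr_ge0 // -natrM ler_nat /N; nia.
Qed.
End Weighted.

(** * Bounds from the simultaneous triple product property *)

(* The simultaneous triple product property for subsets of a finite set [G] of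
   points with coordinates [co] in an abelian group [Z]; [G] itself needs no
   group structure, which makes products and subfamilies painless. *)
Definition coord_STPP (Z : zmodType) (X G J : finType) (co : G -> X -> Z)
    (S T U : J -> {set G}) : Prop :=
  forall i j l s t t' u u' s',
    s \in S i -> t \in T i -> t' \in T j -> u \in U j -> u' \in U l -> s' \in S l ->
    (forall x, co s x - co t x + (co t' x - co u x) + (co u' x - co s' x) = 0) ->
    [/\ i = j, j = l, s = s', t = t' & u = u'].

Section Operations.
Variables (Z : zmodType) (X G J : finType) (co : G -> X -> Z).

Lemma coord_STPP_rot (S T U : J -> {set G}) :
  coord_STPP co S T U -> coord_STPP co T U S.
Proof.
move=> H i j l t u u' s s' t' tT uU u'U sS s'S t'T e.
have [x|-> -> -> -> ->] // := H l i j s' t' t u u' s s'S t'T tT uU u'U sS.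
by rewrite -[RHS](e x) [RHS]addrC [RHS]addrA.
Qed.

Lemma coord_STPP_sub (J' : finType) (f : J' -> J) (S T U : J -> {set G}) :
  injective f -> coord_STPP co S T U -> coord_STPP co (S \o f) (T \o f) (U \o f).
Proof.
move=> finj H i j l s t t' u u' s' h1 h2 h3 h4 h5 h6 e.
by have [/finj -> /finj -> -> -> ->] := H _ _ _ _ _ _ _ _ _ h1 h2 h3 h4 h5 h6 e.
Qed.

Variable E : finType.

Definition prod_coord (g : {ffun E -> G}) (ex : E * X) : Z := co (g ex.1) ex.2.

Definition prod_set (S : E -> J -> {set G}) (f : {ffun E -> J}) : {set {ffun E -> G}} :=
  [set g : {ffun E -> G} | g \in family (fun e => mem (S e (f e)))].

Lemma prod_setP (S : E -> J -> {set G}) (f : {ffun E -> J}) (g : {ffun E -> G}) :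
  reflect (forall e, g e \in S e (f e)) (g \in prod_set S f).
Proof. by rewrite inE; apply: (iffP familyP). Qed.

Lemma card_prod_set (S : E -> J -> {set G}) (f : {ffun E -> J}) : #|prod_set S f| = (\prod_e #|S e (f e)|)%N.
Proof.
rewrite cardsE card_family foldrE big_map enumT.
by apply: eq_bigr.
Qed.

Lemma coord_STPP_prod (S T U : E -> J -> {set G}) :
  (forall e, coord_STPP co (S e) (T e) (U e)) ->
  coord_STPP prod_coord (prod_set S) (prod_set T) (prod_set U).
Proof.
move=> H i j l s t t' u u' s' /prod_setP h1 /prod_setP h2 /prod_setP h3
  /prod_setP h4 /prod_setP h5 /prod_setP h6 eq0.
have K e : [/\ i e = j e, j e = l e, s e = s' e, t e = t' e & u e = u' e].
  by apply: (H e) => // x; apply: (eq0 (e, x)).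
by split; apply/ffunP => e; case: (K e).
Qed.
End Operations.

Lemma dvdn_Zp_add3 (q : nat) (x y z : 'Z_q) : (1 < q)%N ->
  (q %| x + y + z)%N = (x + y + z == 0).
Proof.
move=> q1; rewrite -val_eqE /= modnDml /dvdn.
by congr ((_ %% _)%N == _); rewrite Zp_cast.
Qed.

(** Reversing both coordinates sends the complement of the triangle into the triangle. *)
Lemma card_half_square (n : nat) :
  (n.+1 ^ 2 <= 2 * #|[set ik : 'I_n.+1 * 'I_n.+1 | ik.1 + ik.2 <= n]|)%N.
Proof.
set A := [set _ | _].
pose rv (ik : 'I_n.+1 * 'I_n.+1) := (rev_ord ik.1, rev_ord ik.2).
have rvinj : injective rv.
  move=> [a b] [c d] /eqP; rewrite xpair_eqE !(inj_eq rev_ord_inj).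
  by move=> /andP[/eqP /= -> /eqP /= ->].
have cov : [set: 'I_n.+1 * 'I_n.+1] \subset A :|: rv @^-1: A.
  by apply/subsetP => -[a b] _; rewrite !inE /=; have := ltn_ord a; have := ltn_ord b; lia.
have := subset_leq_card cov.
rewrite cardsT card_prod card_ord => /leq_trans; apply.
by rewrite (leq_trans (leq_card_setU _ _)) // card_preimset // addnn mul2n.
Qed.

(** * Slice-rank bounds for STPP families *)

Section Bounds.
Variables (R : realType) (p m : nat).
Hypotheses (pp : prime p) (m0 : (0 < m)%N).
Let P (X : finType) : R := (gam R * (p ^ m)%:R) ^+ #|X|.

Let q1 : (1 < p ^ m)%N.
Proof. by rewrite -(expn0 p) ltn_exp2l ?prime_gt1. Qed.

Let P_ge0 X : 0 <= P X.
Proof. by rewrite exprn_ge0 // mulr_ge0 // ltW // gam_gt0. Qed.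

(* Strassen: the triples with [i + j + k = n] form a degenerate diagonal of the
   matrix multiplication tensor, the weight of [(i, j, k)] being
   [(i + j + k - n) ^ 2]. *)
Lemma cube_STPP_bound (X G J : finType) (co : G -> X -> 'Z_(p ^ m))
    (S T U : J -> {set G}) (v : nat) :
  coord_STPP co S T U ->
  (forall j, [/\ #|S j| = v, #|T j| = v & #|U j| = v]) ->
  #|J|%:R * v%:R ^+ 2 <= 2 * P X.
Proof.
case: v => [|n] H card; first by rewrite expr0n mulr0 mulr_ge0.
have cS j : n.+1 = #|S j| by case: (card j).
have cT j : n.+1 = #|T j| by case: (card j).
have cU j : n.+1 = #|U j| by case: (card j).
pose s j i := enum_val (cast_ord (cS j) i).
pose t j i := enum_val (cast_ord (cT j) i).
pose u j i := enum_val (cast_ord (cU j) i).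
have sinj j : injective (s j) by move=> i i' /enum_val_inj/cast_ord_inj.
have tinj j : injective (t j) by move=> i i' /enum_val_inj/cast_ord_inj.
have uinj j : injective (u j) by move=> i i' /enum_val_inj/cast_ord_inj.
pose D := [set ik : 'I_n.+1 * 'I_n.+1 | ik.1 + ik.2 <= n]%N.
pose W := (J * {d | d \in D})%type.
pose blk (w : W) := w.1.
pose i1 (w : W) : 'I_n.+1 := (val w.2).1.
pose i2 (w : W) : 'I_n.+1 := (val w.2).2.
pose i3 (w : W) : 'I_n.+1 := inord (n - i1 w - i2 w).
have i123 w : (i1 w + i2 w + i3 w = n)%N.
  have := valP w.2; rewrite inE -/(i1 w) -/(i2 w) => le.
  by rewrite /i3 inordK; lia.
(* A splitting of (i + j + k - n)^2 into three terms of two indices each, up to the constant n^2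
   that is added to the first. *)
pose wt (i j : 'I_n.+1) : int := i%:Z ^+ 2 + 2 * i%:Z * j%:Z - 2 * n%:Z * i%:Z.
pose a w x := nat_of_ord (co (s (blk w) (i1 w)) x - co (t (blk w) (i2 w)) x).
pose b w x := nat_of_ord (co (t (blk w) (i2 w)) x - co (u (blk w) (i3 w)) x).
pose c w x := nat_of_ord (co (u (blk w) (i3 w)) x - co (s (blk w) (i1 w)) x).
have Weq w w' : blk w = blk w' -> i1 w = i1 w' -> i2 w = i2 w' -> w = w'.
  case: w => j [[i k] ?]; case: w' => j' [[i' k'] ?].
  rewrite /blk /i1 /i2 /= => ejj eii ekk.
  by congr pair => //; apply/val_inj; rewrite /= eii ekk.
have main : #|{: W}|%:R <= P X.
  apply: (@weighted_tricolored_card R p m X W a b c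
    (fun w => wt (i1 w) (i2 w) + n%:Z ^+ 2) (fun w => wt (i2 w) (i3 w))
    (fun w => wt (i3 w) (i1 w))) => //.
  - move=> w1 w2 w3 dv.
    have [|||||||e1 e2 e3 e4 e5] := H (blk w1) (blk w2) (blk w3) (s (blk w1) (i1 w1))
      (t (blk w1) (i2 w1)) (t (blk w2) (i2 w2)) (u (blk w2) (i3 w2))
      (u (blk w3) (i3 w3)) (s (blk w3) (i1 w3)); try exact: enum_valP.
      by move=> x; apply/eqP; rewrite -dvdn_Zp_add3 //; apply: dv.
    move: e3 e4 e5; rewrite -e2 -e1 => /sinj e3 /tinj e4 /uinj e5.
    have sq : wt (i1 w1) (i2 w1) + n%:Z ^+ 2 + wt (i2 w2) (i3 w2) + wt (i3 w3) (i1 w3)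
        = ((i1 w1)%:Z + (i2 w1)%:Z + (i3 w2)%:Z - n%:Z) ^+ 2.
      by rewrite /wt -e3 -e4 -e5; ring.
    rewrite sq sqr_ge0; split=> // /eqP; rewrite sqrf_eq0 => /eqP e0.
    have e6 : i2 w3 = i2 w1 by apply: val_inj => /=; have := i123 w3; rewrite -e3 -e5; lia.
    have e7 : i1 w2 = i1 w1 by apply: val_inj => /=; have := i123 w2; rewrite -e4; lia.
    by split; apply: Weq; rewrite -?e1 -?e2 -?e1 ?e6 ?e7 -?e3 -?e4.
  - by move=> w x; rewrite dvdn_Zp_add3 //; apply/eqP; ring.
  - move=> w; rewrite /wt.
    have -> : n%:Z = (i1 w)%:Z + (i2 w)%:Z + (i3 w)%:Z by rewrite -!PoszD i123.
    ring.
(* The factor 2 is lost because the diagonal has only about half of the (n+1)^2 index pairs. *)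
rewrite -natrX -natrM (le_trans (_ : _ <= (2 * #|{: W}|)%:R)) //; last first.
  by rewrite natrM ler_pM2l.
rewrite ler_nat card_prod card_sig mulnCA leq_mul2l; apply/orP; right.
by have := card_half_square n; rewrite cardsE.
Qed.

Definition third (A : Type) (x y z : A) (e : 'I_3) : A :=
  if val e is k.+1 then if k is 0 then y else z else x.

(** The product of the family with its two cyclic rotations has all three sides equal to abc. *)
Lemma rect_STPP_bound (X G J : finType) (co : G -> X -> 'Z_(p ^ m))
    (S T U : J -> {set G}) (a b c : nat) :
  coord_STPP co S T U ->
  (forall j, [/\ #|S j| = a, #|T j| = b & #|U j| = c]) ->
  #|J|%:R ^+ 3 * (a * b * c)%:R ^+ 2 <= 2 * P X ^+ 3.
Proof.
move=> H card.
have HT := coord_STPP_rot H; have HU := coord_STPP_rot HT.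
have Hp : coord_STPP (@prod_coord _ X G co 'I_3) (prod_set (third S T U))
    (prod_set (third T U S)) (prod_set (third U S T)).
  by apply: coord_STPP_prod => -[[|[|[|//]]] //=].
have := cube_STPP_bound (v := (a * b * c)%N) Hp.
rewrite card_ffun card_ord natrX /P card_prod card_ord (mulnC 3) exprM; apply.
move=> f; rewrite !card_prod_set !big_ord_recr !big_ord0 /= /third /=.
have cS j : #|S j| = a by case: (card j).
have cT j : #|T j| = b by case: (card j).
have cU j : #|U j| = c by case: (card j).
by rewrite !cS !cT !cU; split; lia.
Qed.

(** Here w j is the 2/3 power of the volume. Expand the r-th power of the sum and sort the r-tuples
    of blocks by type, the multiplicity of each block. Tuples of one type have the same dimensions,
    so [rect_STPP_bound] applies, and there are at most (r+1)^|J| types. *)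
Lemma STPP_bound (X G J : finType) (co : G -> X -> 'Z_(p ^ m))
    (S T U : J -> {set G}) (w : J -> R) :
  coord_STPP co S T U ->
  (forall j, 0 <= w j) ->
  (forall j, w j ^+ 3 = (#|S j| * #|T j| * #|U j|)%:R ^+ 2) ->
  \sum_j w j <= P X.
Proof.
move=> H w0 w3.
apply: (@le_of_poly_growth _ _ _ 2 #|J|) => // [|r]; first exact: sumr_ge0.
pose cnt (f : {ffun 'I_r -> J}) j := #|[pred e | f e == j]|.
pose cls f : {ffun J -> 'I_r.+1} := [ffun j => inord (cnt f j)].
have cntE f g : cls f = cls g -> cnt f =1 cnt g.
  move=> e j; have := congr1 (fun h : {ffun J -> 'I_r.+1} => val (h j)) e.
  rewrite !ffunE /= !inordK // ltnS /cnt; apply: leq_trans (max_card _) _; by rewrite card_ord.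
have prodE (A : Type) (idx : A) (op : Monoid.com_law idx) (F : J -> A) f g :
    cls f = cls g -> \big[op/idx]_e F (f e) = \big[op/idx]_e F (g e).
  move=> fg.
  have K (h : {ffun 'I_r -> J}) : \big[op/idx]_e F (h e) = \big[op/idx]_j iter (cnt h j) (op (F j)) idx.
    rewrite (partition_big h xpredT) //=; apply: eq_bigr => j _.
    by rewrite -big_const; apply: eq_bigr => e /eqP ->.
  by rewrite !K; apply: eq_bigr => j _; rewrite (cntE _ _ fg).
have bound z : \sum_(f | cls f == z) \prod_e w (f e) <= 2 * P X ^+ r.
  have [f0 /eqP f0z|none] := pickP (fun f => cls f == z); last first.
    by rewrite big_pred0 // mulr_ge0 // exprn_ge0.
  pose V := {f | cls f == z}.
  have fE (f : V) : cls (val f) = cls f0 by rewrite f0z; apply/eqP/(valP f).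
  have Hr : coord_STPP (@prod_coord _ X G co 'I_r) (prod_set (fun=> S) \o val : V -> _)
      (prod_set (fun=> T) \o val) (prod_set (fun=> U) \o val).
    by apply: coord_STPP_sub; [exact: val_inj | exact: coord_STPP_prod].
  have := rect_STPP_bound (a := \prod_e #|S (f0 e)|) (b := \prod_e #|T (f0 e)|)
    (c := \prod_e #|U (f0 e)|) Hr.
  move=> /(_ _)/wrap[|le].
    by move=> f; rewrite /= !card_prod_set; split;
      [exact: (prodE _ _ _ (fun j => #|S j|) (val f) f0 (fE f)) | exact: (prodE _ _ _ (fun j => #|T j|) (val f) f0 (fE f))
      | exact: (prodE _ _ _ (fun j => #|U j|) (val f) f0 (fE f))].
  rewrite (eq_bigr (fun=> \prod_e w (f0 e))); last by move=> f /eqP fz; apply: prodE; rewrite fz.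
  rewrite sumr_const -[X in X <= _]mulr_natl.
  have Pr0 : 0 <= 2 * P X ^+ r by rewrite mulr_ge0 // exprn_ge0.
  have prod0 : 0 <= \prod_e w (f0 e) by rewrite prodr_ge0.
  (* Cubing turns the weights into squared volumes; the constant 2 becomes 8, which leaves room for
     the 2 of [rect_STPP_bound]. *)
  rewrite -(@ler_pXn2r _ 3) ?nnegrE //; last exact: mulr_ge0.
  rewrite !exprMn -prodrXl (eq_bigr _ (fun e _ => w3 (f0 e))) prodrXl -natr_prod.
  rewrite !big_split /=.
  move: le; rewrite /P card_prod card_ord (mulnC r) exprM card_sig => /le_trans; apply.
  apply: ler_wpM2r; first by rewrite !exprn_ge0 // mulr_ge0 // ltW // gam_gt0.
  by rewrite -natrX ler_nat.
have -> : (\sum_j w j) ^+ r = \sum_(f : {ffun 'I_r -> J}) \prod_e w (f e).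
  by rewrite -[in LHS](card_ord r) -prodr_const bigA_distr_bigA.
rewrite (partition_big cls xpredT) //=.
rewrite (le_trans (ler_sum _ (fun z _ => bound z))) //.
by rewrite sumr_const card_ffun card_ord -[X in X <= _]mulr_natr natrX mulrAC.
Qed.
End Bounds.

(** * Skew corner-free sets *)

Definition of_digits (B n : nat) (u : 'I_n -> nat) : nat := (\sum_i u i * B ^ i)%N.

Lemma of_digits_recl B n (u : 'I_n.+1 -> nat) :
  of_digits B u = (u ord0 + B * of_digits B (u \o lift ord0))%N.
Proof.
rewrite /of_digits big_ord_recl expn0 muln1 big_distrr /=; congr (_ + _)%N.
by apply: eq_bigr => i _; rewrite /= /bump leq0n add1n expnS mulnCA.
Qed.

Lemma of_digits_lt B n (u : 'I_n -> nat) : (forall i, u i < B)%N ->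
  (of_digits B u < B ^ n)%N.
Proof.
elim: n u => [|n IH] u ub; first by rewrite /of_digits big_ord0.
have := IH (u \o lift ord0) (fun i => ub _).
rewrite of_digits_recl expnS => lt; apply: (@leq_trans (B * (of_digits B (u \o lift ord0)).+1)%N).
  by rewrite mulnS ltn_add2r.
by rewrite leq_mul2l lt orbT.
Qed.

Lemma of_digits_inj B n (u w : 'I_n -> nat) :
  (forall i, u i < B)%N -> (forall i, w i < B)%N ->
  of_digits B u = of_digits B w -> u =1 w.
Proof.
elim: n u w => [|n IH] u w ub wb; first by move=> _ [].
rewrite !of_digits_recl => e.
have e0 : u ord0 = w ord0.
  have := congr1 (fun x => x %% B)%N e.
  by rewrite ![(B * _)%N]mulnC ![(_ + _ * B)%N]addnC !modnMDl !modn_small.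
move=> i; case: (unliftP ord0 i) => [j|] -> //.
apply: (IH (u \o lift ord0) (w \o lift ord0)) => [k|k|]; [exact: ub|exact: wb|].
have B0 : (0 < B)%N by apply: leq_ltn_trans (ub ord0).
by apply/eqP; rewrite -(eqn_pmul2l B0) -(eqn_add2l (u ord0)) {2}e0; apply/eqP.
Qed.

Section Encode.
Variables (q : nat) (Y : finType).
Hypothesis q1 : (1 < q)%N.

Let v_digits (v : Y -> 'Z_q) (i : 'I_#|Y|) : nat := v (enum_val i).

Let digit_lt (z : 'Z_q) : (z < q)%N.
Proof. by rewrite -[X in (_ < X)%N](Zp_cast q1). Qed.

Lemma encode_subproof (v : Y -> 'Z_q) :
  (of_digits (2 * q) (v_digits v) < (2 * q) ^ #|Y|)%N.
Proof. by apply: of_digits_lt => i; have := digit_lt (v (enum_val i)); rewrite /v_digits; lia. Qed.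

Definition encode (v : Y -> 'Z_q) : 'I_((2 * q) ^ #|Y|) := Ordinal (encode_subproof v).

(* Base [2 * q] leaves room for adding two digits without a carry. *)
Lemma encode_add (a b c d : Y -> 'Z_q) :
  (encode a + encode b = encode c + encode d)%N ->
  forall y, a y + b y = c y + d y.
Proof.
have add (u v : Y -> 'Z_q) :
    (encode u + encode v)%N = of_digits (2 * q) (fun i => v_digits u i + v_digits v i)%N.
  by rewrite /= /of_digits -big_split; apply: eq_bigr => i _; rewrite mulnDl.
rewrite !add => /of_digits_inj H y.
have := H _ _ (enum_rank y); rewrite /v_digits enum_rankK => {}H.
by apply: val_inj => /=; rewrite H // => i;
  rewrite /v_digits ; [have := digit_lt (a (enum_val i)); have := digit_lt (b (enum_val i))
   | have := digit_lt (c (enum_val i)); have := digit_lt (d (enum_val i))]; lia.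
Qed.
End Encode.

Lemma powR_exprn (R : realType) (x e : R) (r : nat) :
  0 <= x -> (x ^+ r) `^ e = (x `^ e) ^+ r.
Proof.
move=> x0; rewrite -[RHS]powR_mulrn ?powR_ge0 // -powRrM -powR_mulrn // -powRrM.
by congr (_ `^ _); apply: mulrC.
Qed.

Lemma le_of_powR_limit (R : realType) (V D : R) : 0 <= V -> 1 <= D ->
  (forall e, 0 < e -> V <= D `^ (1 + e)) -> V <= D.
Proof.
move=> V0 D1 H; have D0 : 0 < D by lra.
move: V0; rewrite le_eqVlt => /orP[/eqP <-|V0]; first exact: ltW.
rewrite -ler_ln ?posrE //; apply/ler_addgt0Pr => e e0.
have L0 : 0 <= ln D by rewrite ln_ge0.
(* The + 1 keeps the denominator positive when D = 1. *)
have k0 : 0 < e / (ln D + 1) by rewrite divr_gt0 //; lra.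
have := H _ k0; rewrite -ler_ln ?posrE ?powR_gt0 // ln_powR => /le_trans; apply.
rewrite mulrDl mul1r lerD2l mulrAC ler_pdivrMr; last by lra.
by rewrite ler_wpM2l //; lra.
Qed.

(** The volume is the number of points (s - t, t - u). The r-th power gives a skew corner-free set
    in a grid of side (2q)^(r|X|); taking r large removes the constant C, and then e tends to 0. *)
Lemma STPP_volume_bound (R : realType) (q : nat) (X G J : finType)
    (co : G -> X -> 'Z_q) (S T U : J -> {set G}) :
  skew_corner_free_bound R -> (1 < q)%N -> coord_STPP co S T U ->
  (\sum_j #|S j| * #|T j| * #|U j|)%N%:R <= (2 * q)%:R ^+ #|X| :> R.
Proof.
move=> skew q1 H.
pose W := {w : J * (G * G * G) | w.2 \in setX (setX (S w.1) (T w.1)) (U w.1)}.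
have -> : (\sum_j #|S j| * #|T j| * #|U j| = #|{: W}|)%N.
  rewrite card_sig -sum1_card.
  under eq_bigr => j _ do rewrite -!cardsX -sum1_card.
  by rewrite pair_big_dep.
pose bl (w : W) := (val w).1.
pose s (w : W) := (val w).2.1.1.
pose t (w : W) := (val w).2.1.2.
pose u (w : W) := (val w).2.2.
have mem (w : W) : [/\ s w \in S (bl w), t w \in T (bl w) & u w \in U (bl w)].
  by have := valP w; rewrite !inE => /andP[/andP[]].
have Weq (w w' : W) : bl w = bl w' -> s w = s w' -> t w = t w' -> u w = u w' -> w = w'.
  rewrite /bl /s /t /u => e1 e2 e3 e4; apply: val_inj.
  move: e1 e2 e3 e4; case: (val w) => ? [[? ?] ?]; case: (val w') => ? [[? ?] ?] /=.
  by move=> -> -> -> ->.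
have HW (w1 w2 w3 : W) :
    (forall x, co (s w1) x - co (t w1) x + (co (t w2) x - co (u w2) x)
               + (co (u w3) x - co (s w3) x) = 0) ->
    [/\ bl w1 = bl w2, bl w2 = bl w3, s w1 = s w3, t w1 = t w2 & u w2 = u w3].
  have [m1 m2 _] := mem w1; have [_ m3 m4] := mem w2; have [m6 _ m5] := mem w3.
  exact: H.
apply: le_of_powR_limit => // [|e e0].
  by rewrite -natrX ler1n expn_gt0; lia.
have [C bound] := skew e e0.
apply: (@le_of_poly_growth _ _ _ C 0); rewrite ?powR_ge0 // => r.
rewrite expr0 mulr1.
pose Y := ('I_r * X)%type.
pose A (f : {ffun 'I_r -> W}) (y : Y) := co (s (f y.1)) y.2 - co (t (f y.1)) y.2.
pose B (f : {ffun 'I_r -> W}) (y : Y) := co (t (f y.1)) y.2 - co (u (f y.1)) y.2.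
(* The first equation is an STPP relation for (f1, f2, f2), giving equal blocks, s and t; the second
   is one for (f3, f1, f2), giving equal u. A skew corner satisfies both, and f3 = f1 yields
   injectivity. *)
have key f1 f2 f3 : encode q1 (A f1) = encode q1 (A f2) ->
    (encode q1 (A f3) + encode q1 (B f1) = encode q1 (A f1) + encode q1 (B f2))%N ->
    f1 = f2.
  move=> eA /encode_add eq3.
  have {}eA y : A f1 y = A f2 y.
    have := @encode_add q _ q1 (A f1) (A f1) (A f2) (A f1).
    by rewrite eA => /(_ erefl y) /addIr.
  apply/ffunP => i.
  have [|b12 _ s12 t12 _] := HW (f1 i) (f2 i) (f2 i).
    move=> x; have := eA (i, x); rewrite /A /= => ->; ring.
  have [|_ _ _ _ u12] := HW (f3 i) (f1 i) (f2 i).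
    move=> x; have := eq3 (i, x); rewrite eA /A /B /= => ->; ring.
  exact: Weq.
pose pt f := (encode q1 (A f), encode q1 (B f)).
have ptinj : injective pt.
  by move=> f g /eqP; rewrite xpair_eqE => /andP[/eqP eA /eqP eB]; apply: (key f g f eA); rewrite eB.
have sk : skew_corner_free [set pt f | f in [set: {ffun 'I_r -> W}]].
  move=> x y y1 x2 y2 d d0 ey ex [/imsetP[f1 _ [xE yE]] /imsetP[f2 _ [xE' yE']] /imsetP[f3 _ [xE3 yE3]]].
  have f12 : f1 = f2.
    apply: (key f1 f2 f3); first by rewrite -xE.
    by rewrite -xE -xE3 -yE -yE'; lia.
  move: ey; rewrite yE' yE f12; move: d0; lia.
have N0 : (0 < (2 * q) ^ #|{: Y}|)%N by rewrite expn_gt0; lia.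
have := bound _ N0 _ sk.
rewrite card_imset // cardsT card_ffun card_ord natrX => /le_trans; apply.
rewrite card_prod card_ord (mulnC r) expnM !natrX.
by rewrite powR_exprn // exprn_ge0.
Qed.

(** * Interpolation *)

(** Condition (2) identifies the three blocks; commutativity then regroups the differences by set
    for the TPP. *)
Lemma STPP_coord (q l k : nat) (S T U : 'I_k -> {set 'rV['Z_q]_l}) :
  STPP S T U -> coord_STPP (fun (v : 'rV['Z_q]_l) x => v 0 x) S T U.
Proof.
move=> [tpp sim] i j h s t t' u u' s' sS tT t'T uU u'U s'S eq0.
have e : (s - t) + (t' - u) + (u' - s') = 0.
  by apply/rowP => x; rewrite !mxE; apply: eq0.
have [||||ij jh] := sim i j h (s * t^-1)%g (t' * u^-1)%g (u' * s'^-1)%g.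
- by rewrite mem_mulg // memV_invg.
- by rewrite mem_mulg // memV_invg.
- by rewrite mem_mulg // memV_invg.
- by rewrite !FinRing.zmodMgE !FinRing.zmodVgE FinRing.zmod1gE.
subst h j.
have [//|-> -> ->//] := tpp i s s' t' t u' u sS s'S t'T tT u'U uU.
rewrite !FinRing.zmodMgE !FinRing.zmodVgE FinRing.zmod1gE -e.
by apply/rowP => x; rewrite !mxE; ring.
Qed.

(** With c^16 = 2 / gam, one gets (c gam)^16 = 2 gam^15 = 2 (27/32)^5 < 1. *)
Lemma gam_tangent_slope (R : realType) :
  exists c : R, [/\ 0 < c, c ^+ 16 = 2 / gam R & c * gam R <= 1].
Proof.
have g0 := gam_gt0 R.
have r0 : 0 < 2 / gam R by rewrite divr_gt0.
exists ((2 / gam R) `^ 16%:R^-1); set c := _ `^ _.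
have c0 : 0 < c by rewrite powR_gt0.
have c16 : c ^+ 16 = 2 / gam R by rewrite powR_rootK // ltW.
split=> //.
have cg0 : 0 <= c * gam R by rewrite mulr_ge0 // ltW.
rewrite -(@expr_le1 _ 16 _ isT cg0).
rewrite exprMn c16 (exprS _ 15) mulrA divfK ?gt_eqF // (exprM _ 3 5) gam_exp3; lra.
Qed.

(* Interpolates the exponent 11/16 between 2/3 and 1 with weights 15/16 and 1/16. *)
Lemma sum_powR_interpolation (R : realType) (J : finType) (v : J -> nat) (P c : R) :
  0 < c -> \sum_j (v j)%:R `^ (2 / 3) <= P -> (\sum_j v j)%N%:R <= c ^+ 16 * P ->
  \sum_j (v j)%:R `^ (11 / 16) <= c * P.
Proof.
move=> c0 HW HV.
(* The exponents 2/3, 11/16 and 1 are 32/48, 33/48 and 48/48. *)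
pose y j : R := (v j)%:R `^ 48^-1.
have y0 j : 0 <= y j by rewrite powR_ge0.
have yE j n : (v j)%:R `^ (n%:R / 48) = y j ^+ n.
  by rewrite mulrC powRrM powR_mulrn ?powR_ge0.
have e32 j : (v j)%:R `^ (2 / 3) = y j ^+ 32 by rewrite -yE; congr (_ `^ _); field.
have e33 j : (v j)%:R `^ (11 / 16) = y j ^+ 33 by rewrite -yE; congr (_ `^ _); field.
have e48 j : (v j)%:R = y j ^+ 48 by rewrite -yE divff ?powRr1 // pnatr_eq0.
rewrite (eq_bigr _ (fun j _ => e32 j)) in HW.
rewrite (eq_bigr _ (fun j _ => e33 j)).
rewrite natr_sum (eq_bigr _ (fun j _ => e48 j)) in HV.
(* Bernoulli at z = y / c gives 16 z <= 15 + z^16; multiply by c y^32 / 16. *)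
have tangent j : y j ^+ 33 <= c * (15 * y j ^+ 32 + y j ^+ 48 / c ^+ 16) / 16.
  have h1 : -1 <= y j / c - 1 by rewrite lerBrDr addNr divr_ge0 // ltW.
  have := bernoulli 16 h1; rewrite [1 + (_ - 1)]addrC subrK expr_div_n => b.
  have yc : y j = c * (y j / c) by rewrite mulrC divfK // gt_eqF.
  have le : y j <= c * (15 + y j ^+ 16 / c ^+ 16) / 16.
    rewrite {1}yc -mulrA ler_pM2l //; lra.
  rewrite exprS; apply: le_trans (ler_wpM2r (exprn_ge0 32 (y0 j)) le) _.
  by rewrite (exprD _ 32 16) le_eqVlt; apply/orP; left; apply/eqP; field; rewrite gt_eqF.
apply: le_trans (ler_sum _ (fun j _ => tangent j)) _.
rewrite -mulr_suml -mulr_sumr big_split /= -mulr_sumr -mulr_suml -mulrA ler_pM2l //.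
have c16 : 0 < c ^+ 16 by rewrite exprn_gt0.
have : (\sum_j y j ^+ 48) / c ^+ 16 <= P by rewrite ler_pdivrMr // mulrC.
move: HW; set a := \sum_j _; set b := _ / _; lra.
Qed.

Theorem theorem1p3 (R : realType) :
  skew_corner_free_bound R ->
  ~ achieves_omega2_STPP R prime_power_homocyclic.
Proof.
move=> skew /(_ (1 / 16))[|gT [k [S [T [U [[q [l [[p [m [pp m0 qE]]] l0 gE]]] HS]]]]]].
  by lra.
subst gT.
have q1 : (1 < q)%N by rewrite qE -(expn0 p) ltn_exp2l ?prime_gt1.
have H := STPP_coord HS.
pose v (j : 'I_k) := (#|S j| * #|T j| * #|U j|)%N.
have HV := STPP_volume_bound skew q1 H.
have HW : \sum_j (v j)%:R `^ (2 / 3) <= (gam R * q%:R) ^+ l.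
  rewrite -[l in _ ^+ l]card_ord; subst q.
  apply: (STPP_bound pp m0 H) => j; first exact: powR_ge0.
  rewrite -powR_mulrn ?powR_ge0 // -powRrM -[RHS]powR_mulrn //.
  by congr (_ `^ _); field.
have [c [c0 c16 cg]] := gam_tangent_slope R.
apply/negP; rewrite -leNgt.
have -> : (2 + 1 / 16) / 3 = 11 / 16 :> R by field.
(* The two bounds differ by the factor (2 / gam)^l = (c^l)^16. *)
apply: le_trans (sum_powR_interpolation (c := c ^+ l) _ HW _) _.
- exact: exprn_gt0.
- rewrite exprAC c16 -exprMn mulrA divfK ?gt_eqF ?gam_gt0 //.
  by move: HV; rewrite card_ord natrM.
rewrite card_mx mul1n card_ord Zp_cast // natrX -exprMn mulrA.
apply: lerXn2r; rewrite ?nnegrE //; last by rewrite ler_piMl.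
by apply: mulr_ge0 => //; apply: mulr_ge0; apply: ltW; rewrite ?gam_gt0.
Qed.
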